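(* Let $\epsilon>0$ be fixed and sufficiently small, and let $x$ be sufficiently large depending on $\epsilon$. Then there are at least $$x \exp\Big(-\big(\tfrac{3\sqrt{2}}{2}+\epsilon\big)\sqrt{\log x \log\log x}\Big)$$ positive integers $n\leq x$ such that $$t_n \leq \exp\left(\sqrt{(2+\epsilon)\log n \log\log n}\right).$$
   Context: For a positive integer $n$, $t_n$ is defined as follows: if $n$ is a perfect square then $t_n=0$; otherwise $t_n$ is the least positive integer such that there are integers $1\leq j_1<\cdots<j_s=t_n$ (with $s\ge 1$) for which $n\prod_{i=1}^s(n+j_i)$ is a perfect square. *)

(* Defs.v *)
From HB Require Import structures.
From mathcomp Require Import all_boot all_order all_algebra.
From mathcomp Require Import all_classical all_reals all_analysis.
From mathcomp Require Import zify.

Set Implicit Arguments.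
Unset Strict Implicit.
Unset Printing Implicit Defensive.

Definition perfect_square (k : nat) : Prop := exists m : nat, k = (m ^ 2)%N.

(* [js] is the list j_1, ..., j_s: [path ltn 0 js] says 0 < j_1 < ... < j_s. *)
Definition square_chain (n t : nat) : Prop :=
  exists js : seq nat,
    [/\ js != [::], path ltn 0 js, last 0%N js = t &
        perfect_square (n * \prod_(j <- js) (n + j))].

(* Needed for [ex_minn]: n * (n + 3n) = (2n)^2 when n > 0. *)
Lemma square_chain_exists (n : nat) : exists t : nat, `[< square_chain n t >].
Proof.
case: n => [|n].
  exists 1%N; apply/asboolP; exists [:: 1%N]; split=> //.
  by exists 0%N; rewrite mul0n.
exists (3 * n.+1)%N; apply/asboolP; exists [:: (3 * n.+1)%N]; split=> //.
by exists (2 * n.+1)%N; rewrite big_seq1; lia.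
Qed.

Definition tn (n : nat) : nat :=
  if `[< perfect_square n >] then 0%N else ex_minn (square_chain_exists n).

(* Main.v *)
Require Import Defs.
From mathcomp Require Import all_boot all_order all_algebra.
From mathcomp Require Import all_classical all_reals all_analysis.
From mathcomp Require Import fintype finset zify ring lra.
Import Order.TTheory GRing.Theory Num.Theory.

(* Write L = exp (sqrt (log x loglog x)), s = sqrt 2, and let y be about
   L ^ (1 / s). Among more than y + 1 integers all of whose prime factors are at
   most y, some nonempty subset has a square product, by linear dependence of
   the exponent vectors mod 2; if they all lie in an interval of length H, the
   least element n of the subset has t_n <= H. There are at least
   x L ^ (- s / 2 - o(1)) y-smooth integers up to x, so for
   H = L ^ (s + eps / 4) the intervals of length H containing at most y + 1 of
   them account for a negligible part, and the others, each containing at most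
   H, number at least x L ^ (- 3 s / 2 - o(1)).

   The lower bound for the number psi of smooth integers must be of the quality
   x u ^ (- u) with u = log x / log y. Counting the pairs (p, n) with p | n gives
   sum_p psi (N / p) <= M psi N when p runs through primes in [z, y] and
   N < z ^ (M + 1). It is iterated about u times with z = y ^ (1 - delta): here
   M = O(u), while sum_p 1 / p is at least a constant depending only on delta,
   by Mertens' first theorem. What remains is a cofactor of size at most about
   y ^ (delta u), for which the loss of (log x) ^ 2 per step incurred by taking
   all primes up to y is affordable. *)

Local Open Scope nat_scope.

(** * Square products in short intervals *)

Definition smooth (y n : nat) : bool := ([pred p | (p <= y)%N] : nat_pred).-nat n.

Lemma smooth_gt0 y n : smooth y n -> 0 < n.
Proof. by case/andP. Qed.

Lemma logn_smooth0 {y n p} : smooth y n -> (y < p) -> logn p n = 0.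
Proof.
move=> sn yp; apply/eqP; rewrite -leqn0 leqNgt logn_gt0; apply/negP => pn.
by case/andP: sn => _ /allP/(_ _ pn); rewrite inE leqNgt yp.
Qed.

Lemma perfect_square_logn m : (0 < m) ->
  (forall p, prime p -> ~~ odd (logn p m)) -> perfect_square m.
Proof.
move=> m0 ev; exists (\prod_(p <- primes m) p ^ (logn p m)./2).
rewrite {1}[m]prod_prime_decomp // prime_decompE big_map /= [RHS]expnE /= -big_split /=.
rewrite !big_seq; apply: eq_bigr => p; rewrite mem_primes => /andP[pp _].
by rewrite -expnD addnn even_halfK // ev.
Qed.

Lemma logn_prod (I : Type) (r : seq I) (P : pred I) (F : I -> nat) p :
  (forall i, P i -> 0 < F i) ->
  logn p (\prod_(i <- r | P i) F i) = (\sum_(i <- r | P i) logn p (F i)).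
Proof.
move=> F0; elim: r => [|i r IH]; first by rewrite !big_nil logn1.
rewrite !big_cons; case: ifP => // Pi; rewrite lognM ?IH ?F0 //.
by apply: prodn_cond_gt0.
Qed.

(* Linear algebra over F_2 in disguise: two of the 2 ^ #|A| subsets of A have
   the same vector of parities of exponents, and their symmetric difference
   multiplies to a square. *)
Lemma square_subproduct {y n} (A : {set 'I_n}) :
  {in A, forall i : 'I_n, smooth y i} -> (y.+1 < #|A|) ->
  exists D : {set 'I_n},
    [/\ D != set0, D \subset A & perfect_square (\prod_(i in D) (i : nat))].
Proof.
move=> sm cA.
(* The coordinates are all of 0, ..., [y], not only the primes; the crude dimension [y.+1] is
   affordable. *)
pose f (B : {set 'I_n}) : {ffun 'I_y.+1 -> bool} :=
  [ffun p : 'I_y.+1 => odd (\sum_(i in B) logn p i)].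
have [B [C [BA CA BC fBC]]] : exists B C : {set 'I_n},
    [/\ B \subset A, C \subset A, B != C & f B = f C].
  apply/not_existsP => nex.
  have inj : {in powerset A &, injective f}.
    move=> B C; rewrite !inE => BA CA fBC; apply/eqP/negPn/negP => BC.
    by apply: (nex B); exists C.
  have := max_card (mem (f @: powerset A)).
  rewrite (card_in_imset inj) card_powerset card_ffun card_bool card_ord.
  by rewrite leq_exp2l // leqNgt cA.
pose D := (B :\: C) :|: (C :\: B).
have DA : D \subset A by rewrite subUset !(subset_trans (subsetDl _ _)).
exists D; split => //.
  apply: contra BC => /eqP D0; apply/eqP/setP => i.
  by have := congr1 (fun X : {set _} => i \in X) D0; rewrite !inE; do 2 case: (_ \in _).
have Dpos (i : 'I_n) : i \in D -> (0 < i).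
  by move=> iD; apply: (@smooth_gt0 y); apply: sm; apply: (subsetP DA).
apply: perfect_square_logn; first exact: prodn_cond_gt0.
move=> p pp; rewrite logn_prod //.
have [yp|py] := ltnP y p.
  by rewrite big1 // => i iD; apply: logn_smooth0 yp; apply: sm; apply: (subsetP DA).
have := congr1 (fun g : {ffun _ -> bool} => g (Ordinal (py : p < y.+1))) fBC.
rewrite !ffunE /= => par.
have split_sum (X Y : {set 'I_n}) : (\sum_(i in X) logn p i =
    \sum_(i in X :&: Y) logn p i + \sum_(i in X :\: Y) logn p i).
  by rewrite (big_setID Y).
have -> : (\sum_(i in D) logn p i =
    \sum_(i in B :\: C) logn p i + \sum_(i in C :\: B) logn p i).
  rewrite (split_sum D C) addnC; congr (_ + _); apply: eq_bigl => i;
    by rewrite !inE; do 2 case: (_ \in _).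
move: par; rewrite (split_sum B C) (split_sum C B) setIC !oddD.
by do 3 case: (odd _).
Qed.

(** For the least element [n] of [D], the other elements are [n + j] with 0 < j < [H], so these [j]
    form a square chain. *)
Lemma tn_le_of_square {a H} {D : seq nat} : D != [::] -> uniq D ->
  (forall i, i \in D -> (0 < a <= i) && (i < a + H)) ->
  perfect_square (\prod_(i <- D) i) ->
  exists2 n, n \in D & (tn n <= H).
Proof.
move=> D0 Du Drange sq.
have exD : exists n, n \in D.
  by case: D D0 {Du Drange sq} => // d D _; exists d; rewrite mem_head.
have [n nD nmin] := ex_minnP exD.
exists n => //; rewrite /tn; case: asboolP => // nsq.
case: ex_minnP => t _ tmin.
pose js := [seq j <- iota 1 H | (n + j) \in D].
have pjs : perm_eq D (n :: [seq (n + j) | j <- js]).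
  apply: uniq_perm => //=.
    rewrite map_inj_uniq; last exact: addnI.
    rewrite filter_uniq ?iota_uniq // andbT; apply/negP => /mapP[j].
    by rewrite mem_filter mem_iota => /andP[_]; lia.
  move=> i; rewrite inE; apply/idP/idP => [iD|/predU1P[->//|/mapP[j]]].
    have [/eqP->//|ni] := boolP (i == n); apply/orP; right.
    have := nmin i iD; have := Drange _ iD; have := Drange _ nD => *.
    apply/mapP; exists (i - n); last by lia.
    rewrite mem_filter mem_iota; apply/andP; split; last by lia.
    by rewrite (_ : n + _ = i) //; lia.
  by rewrite mem_filter => /andP[jD _] ->.
have prodD : (\prod_(i <- D) i = n * \prod_(j <- js) (n + j)).
  by rewrite (perm_big _ pjs) big_cons big_map.
(* If [n] were alone in [D], it would be a square, and that case is settled by [tn n = 0]. *)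
have js0 : js != [::].
  apply/eqP => js0; apply: nsq; move: sq; rewrite prodD js0 big_nil muln1 //.
have sc : square_chain n (last 0 js).
  exists js; split => //; last by rewrite -prodD.
  rewrite path_sortedE; last exact: ltn_trans.
  rewrite sorted_filter ?iota_ltn_sorted //; last exact: ltn_trans.
  by rewrite andbT; apply/allP => j; rewrite mem_filter mem_iota => /andP[_ /andP[]].
apply: leq_trans (tmin _ _) _; first exact/asboolP/sc.
have : last 0 js \in js by case: js js0 {pjs prodD sc} => //= j s _; apply: mem_last.
by rewrite mem_filter mem_iota => /andP[_]; lia.
Qed.

Definition psi (y N : nat) : nat := count (smooth y) (iota 1 N).

(** A single [n] with [P n] pays for the whole interval through the factor [H]. If there is none,
    more than [y.+1] smooth elements would have a square subproduct and so produce one. *)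
Lemma count_smooth_interval {a H y} (P : pred nat) : (0 < a) ->
  (forall n, (tn n <= H) -> P n) ->
  (count (smooth y) (iota a H) <= y.+1 + H * count P (iota a H)).
Proof.
move=> a0 hP; have [hs|nhs] := boolP (has P (iota a H)).
  apply: leq_trans (leq_addl _ _); apply: leq_trans (count_size _ _) _.
  by rewrite size_iota leq_pmulr // -has_count.
apply: leq_trans (leq_addr _ _); rewrite leqNgt; apply/negP => big.
move/hasPn: nhs => nhs.
pose A := [set i : 'I_(a + H) | (a <= i) && smooth y i].
have cA : (y.+1 < #|A|).
  apply: leq_trans big _; rewrite cardE -(size_map val) -size_filter.
  apply: uniq_leq_size => [|i]; first by rewrite filter_uniq ?iota_uniq.
  rewrite mem_filter mem_iota => /andP[si /andP[ai iH]].
  by apply/mapP; exists (Ordinal iH) => //; rewrite mem_enum inE ai.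
have [|D [D0 DA sq]] := square_subproduct _ _ cA.
  by move=> i; rewrite inE => /andP[].
have Dmem i : i \in map val (enum D) -> (a <= i) && (i < a + H).
  by case/mapP => j; rewrite mem_enum => /(subsetP DA); rewrite inE => /andP[? _] ->;
     rewrite ltn_ord andbT.
have [||||n /Dmem nI tnH] := @tn_le_of_square a H (map val (enum D)).
- apply: contra D0; case E: (enum D) => // _; apply/eqP/setP => i.
  by rewrite -mem_enum E !inE.
- by rewrite map_inj_uniq ?enum_uniq //; apply: val_inj.
- by move=> i /Dmem; rewrite a0.
- by rewrite big_map big_enum.
by have := nhs n; rewrite mem_iota nI => /(_ isT); rewrite hP.
Qed.

Lemma count_iota_blocks (P : pred nat) a H K :
  count P (iota a (K * H)) = (\sum_(k < K) count P (iota (a + k * H) H)).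
Proof.
elim: K => [|K IH]; first by rewrite big_ord0.
by rewrite big_ord_recr /= -IH mulSn addnC iotaD count_cat.
Qed.

(** Cut 1, ..., [N] into [N %/ H] blocks of length [H]; the incomplete last block accounts for the
    lone summand [H]. *)
Lemma psi_le_count_tn {y H N} : (0 < H) ->
  (psi y N <= (N %/ H) * y.+1 + H + H * count (fun n => tn n <= H) (iota 1 N)).
Proof.
move=> H0; rewrite /psi {1 3}(divn_eq N H) iotaD !count_cat.
set r := (N %% H); set q := (N %/ H).
have rH : (r <= H) by rewrite ltnW // ltn_mod.
have c2 : (count (smooth y) (iota (1 + q * H) r) <= H).
  by apply: leq_trans (count_size _ _) _; rewrite size_iota.
have c1 : (count (smooth y) (iota 1 (q * H)) <=
    q * y.+1 + H * count (fun n => tn n <= H) (iota 1 (q * H))).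
  rewrite !count_iota_blocks big_distrr /= -[X in (X * y.+1)]card_ord -sum_nat_const.
  rewrite -big_split /=; apply: leq_sum => k _.
  exact: count_smooth_interval.
move: c1 c2; set u := count _ _; set v := count _ _; set w := count _ _; set z := count _ _.
by rewrite mulnDr; lia.
Qed.

(** * Recursive inequalities for smooth integers *)

Lemma prod_primes_dvd (P : pred nat) a b n : 0 < n ->
  (forall p, P p -> (a <= p < b) -> prime p && (p %| n)) ->
  (\prod_(a <= p < b | P p) p %| n).
Proof.
move=> n0 hP; rewrite -big_filter.
have {hP}: all (fun p => prime p && (p %| n)) [seq p <- index_iota a b | P p].
  by apply/allP => p; rewrite mem_filter mem_index_iota => /andP[/hP].
have : uniq [seq p <- index_iota a b | P p] by rewrite filter_uniq ?iota_uniq.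
elim: [seq p <- _ | _] => [|p s IH] /=; first by rewrite big_nil dvd1n.
move=> /andP[ps us] /andP[/andP[pp pn] als].
rewrite big_cons Gauss_dvd ?pn ?IH // prime_coprime //.
rewrite Euclid_dvd_prod //; apply/negP; rewrite big_has_cond.
move=> /hasP[q qs /andP[_ pq]]; move/allP: als => /(_ q qs)/andP[qp _].
by move: pq ps; rewrite dvdn_prime2 // => /eqP ->; rewrite qs.
Qed.

(** The product of these distinct primes divides [n] and is at least [z] to the power of their
    number. *)
Lemma count_prime_divisors {z w M n} : (0 < n < z ^ M.+1) ->
  (\sum_(z <= p < w | prime p && (p %| n)) 1 <= M).
Proof.
move=> /andP[n0 nz]; case: z nz => [|z]; first by rewrite exp0n // ltn0.
case: z => [|z] nz; first by move: nz; rewrite exp1n; lia.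
rewrite -ltnS -(ltn_exp2l _ _ (isT : 1 < z.+2)); apply: leq_ltn_trans nz.
have := @prod_primes_dvd (fun p => prime p && (p %| n)) z.+2 w n n0.
move=> /(_ (fun p h _ => h))/(dvdn_leq n0); apply: leq_trans.
rewrite big_nat_cond [leqRHS]big_nat_cond.
elim/big_rec2: _ => // p a b /andP[/andP[zp _] _] le.
by rewrite expnS leq_mul.
Qed.

(** Multiplication by [p] is injective and preserves smoothness. *)
Lemma psi_div_le {y N p} : prime p -> (p <= y) ->
  (psi y (N %/ p) <= count (fun n => smooth y n && (p %| n)) (iota 1 N)).
Proof.
move=> pp py; rewrite /psi -!size_filter -(size_map (muln p)).
have p0 := prime_gt0 pp.
apply: uniq_leq_size.
  rewrite map_inj_uniq ?filter_uniq ?iota_uniq // => a b /eqP.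
  by rewrite eqn_pmul2l // => /eqP.
move=> ? /mapP[n]; rewrite !mem_filter !mem_iota => /andP[sn /andP[n0 nN]] ->.
rewrite dvdn_mulr // andbT muln_gt0 p0 n0 /smooth pnatM pnatE // inE py /=.
apply/andP; split; first exact: sn.
move: nN; rewrite !add1n !ltnS leq_divRL // mulnC //.
Qed.

Lemma sum_psi_div_le {y z w M N} : (w <= y) -> (N < z ^ M.+1) ->
  (\sum_(z <= p < w.+1 | prime p) psi y (N %/ p) <= M * psi y N).
Proof.
move=> wy NM.
apply: (@leq_trans (\sum_(z <= p < w.+1 | prime p)
    \sum_(n <- iota 1 N | smooth y n && (p %| n)) 1)).
  rewrite big_nat_cond [leqRHS]big_nat_cond; apply: leq_sum => p.
  move=> /andP[/andP[_ pw] pp]; rewrite sum1_count; apply: psi_div_le => //.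
  exact: leq_trans wy.
rewrite /psi -sum1_count big_distrr /= muln1.
rewrite (exchange_big_dep (smooth y)) /=; last by move=> ? ? _ /andP[].
rewrite big_seq_cond [leqRHS]big_seq_cond; apply: leq_sum => n.
rewrite mem_iota => /andP[/andP[n0 nN] sn]; rewrite sn.
by apply: count_prime_divisors; rewrite n0 /=; apply: leq_ltn_trans NM; lia.
Qed.

(** Take z = 2 in the double count and use that [psi y] is monotone. *)
Lemma psi_div_mul_le {y M N} : (N < 2 ^ M.+1) ->
  ((\sum_(2 <= p < y.+1 | prime p) 1) * psi y (N %/ y) <= M * psi y N).
Proof.
move=> NM; apply: leq_trans (sum_psi_div_le (leqnn y) NM).
rewrite big_distrl /= big_nat_cond [leqRHS]big_nat_cond; apply: leq_sum => p.
move=> /andP[/andP[p2 py] _]; rewrite mul1n /psi.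
rewrite -(subnKC (leq_div2l N (ltnW p2) (py : p <= y))) iotaD count_cat.
exact: leq_addr.
Qed.

Lemma psi_small {y N} : (N <= y) -> psi y N = N.
Proof.
move=> Ny; rewrite /psi -[RHS](size_iota 1); apply/eqP; rewrite -all_count.
apply/allP => n; rewrite mem_iota => /andP[n0 nN].
apply/andP; split => //; apply/allP => p; rewrite mem_primes inE => /and3P[_ _ pn].
by apply: leq_trans (dvdn_leq n0 pn) _; lia.
Qed.

(** * Mertens' first theorem *)

Lemma prime_ndvd_fact p n : prime p -> n < p -> ~~ (p %| n`!).
Proof.
move=> pp; elim: n => [|n IH] np; first by rewrite dvdn1 gtn_eqF // prime_gt1.
by rewrite factS Euclid_dvdM // negb_or IH 1?ltnW // gtnNdvd.
Qed.

(** The two equal middle coefficients both occur in the expansion of (1 + 1) ^ (2m + 1), which is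
    twice 4 ^ m. *)
Lemma bin_middle_odd_le m : 'C(m.*2.+1, m) <= 4 ^ m.
Proof.
rewrite -(leq_pmul2l (isT : 0 < 2)) (_ : 2 * 4 ^ m = 2 ^ m.*2.+1); last first.
  by rewrite expnS -mul2n expnM.
have -> : 2 ^ m.*2.+1 = \sum_(0 <= i < m.*2.+2) 'C(m.*2.+1, i).
  rewrite big_mkord -[2]/(1 + 1) expnDn; apply: eq_bigr => i _.
  by rewrite !exp1n !muln1.
rewrite (@big_cat_nat _ _ _ m) //=; last by rewrite -addnn; lia.
apply: leq_trans (leq_addl _ _).
rewrite big_ltn; last by rewrite -addnn; lia.
rewrite big_ltn; last by rewrite -addnn; lia.
rewrite addnA; apply: leq_trans (leq_addr _ _).
rewrite -(@bin_sub m.*2.+1 m.+1); last by rewrite -addnn; lia.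
by rewrite (_ : m.*2.+1 - m.+1 = m) -?addnn; lia.
Qed.

(** Strong induction after Erdős: an even n > 2 contributes no prime, and for n = 2m + 1 the primes
    in [m + 2, n] all divide the middle binomial coefficient. *)
Lemma primorial_le n : \prod_(0 <= p < n.+1 | prime p) p <= 4 ^ n.
Proof.
elim/ltn_ind: n => n IH; have [n2|n2] := leqP n 2.
  by case: n n2 {IH} => [|[|[|]]] // _; rewrite !big_mkcond !big_nat_recr //= big_geq.
case: (boolP (odd n)) => [on|en]; last first.
  rewrite big_mkcond big_nat_recr //= -big_mkcond /=.
  case: ifP => [pn|_]; first by case: (even_prime pn) => [|on]; [lia | rewrite on in en].
  rewrite muln1; case: n n2 {en} IH => // n n2 IH.
  by apply: leq_trans (IH n _) _; rewrite ?leq_exp2l.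
have [m nE] : exists m, n = m.*2.+1 by exists n./2; rewrite -[LHS]odd_double_half on.
have m0 : 0 < m by move: n2; rewrite nE -addnn; lia.
have mn : m.+2 <= n.+1 by rewrite nE -addnn; lia.
rewrite (@big_cat_nat _ _ _ m.+2) //=.
have -> : 4 ^ n = 4 ^ m.+1 * 4 ^ m by rewrite -expnD nE -addnn addSn.
apply: leq_mul; first by apply: IH; rewrite nE -addnn; lia.
apply: leq_trans (bin_middle_odd_le m); apply: dvdn_leq.
  by rewrite bin_gt0 -addnn; lia.
apply: prod_primes_dvd; first by rewrite bin_gt0 -addnn; lia.
move=> p pp /andP[mp pn]; rewrite pp /=.
have : p %| n`! by rewrite dvdn_fact // prime_gt0.
rewrite -(@bin_fact n m); last by rewrite nE -addnn; lia.
rewrite nE !Euclid_dvdM // => /orP[//|/orP[]].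
  by apply: contraTT => _; rewrite prime_ndvd_fact //; lia.
by apply: contraTT => _; rewrite prime_ndvd_fact // -addnn; lia.
Qed.

Lemma logn_fact_le p n : prime p -> p.-1 * logn p n`! <= n.
Proof.
move=> pp; rewrite logn_fact //.
have p1 := prime_gt1 pp.
suff: forall K, p.-1 * \sum_(1 <= k < K.+1) n %/ p ^ k + n %/ p ^ K <= n.
  by move=> /(_ n); apply: leq_trans; apply: leq_addr.
elim=> [|K IH]; first by rewrite big_geq // muln0 divn1.
rewrite big_nat_recr //= mulnDr -addnA; apply: leq_trans IH; rewrite leq_add2l.
have := leq_trunc_div (n %/ p ^ K) p; rewrite -divnMA -expnSr mulnC.
by move: (n %/ p ^ K.+1) (n %/ p ^ K) => u v; case: p pp p1 => //= p _ _; nia.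
Qed.

Lemma logn_fact_ge p n : prime p -> n %/ p <= logn p n`!.
Proof.
move=> pp; rewrite logn_fact //; case: n => [|n]; first by rewrite div0n.
by rewrite big_ltn // expn1 leq_addr.
Qed.

Lemma prod_logn n m : 0 < n <= m ->
  n = \prod_(0 <= p < m.+1 | prime p) p ^ logn p n.
Proof.
move=> /andP[n0 nm]; rewrite -[LHS](partnT n0) (widen_partn _ nm).
rewrite big_mkcond [RHS]big_mkcond; apply: eq_bigr => p _ /=.
by case: ifP => // np; rewrite lognE np.
Qed.

Local Open Scope ring_scope.


Section Mertens.
Context {R : realType}.
Implicit Types (n m p y z : nat).
Local Notation lnn n := (ln (n%:R : R)).

(** At n = 0 this relies on the convention ln 0 = 0. *)
Lemma lnn_ge0 n : 0 <= lnn n.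
Proof. by case: n => [|n]; [rewrite ln0 | rewrite ln_ge0 // ler1n]. Qed.

Lemma lnn_prod (r : seq nat) (P : pred nat) (F : nat -> nat) :
  (forall i, P i -> 0 < F i)%N ->
  lnn (\prod_(i <- r | P i) F i)%N = \sum_(i <- r | P i) lnn (F i).
Proof.
move=> F0; elim: r => [|i r IH]; first by rewrite !big_nil ln1.
rewrite !big_cons; case: ifP => // Pi; rewrite natrM lnM ?IH // posrE ltr0n ?F0 //.
exact: prodn_cond_gt0.
Qed.

Lemma lnn_fact m : lnn m`! = \sum_(0 <= p < m.+1 | prime p) lnn p * (logn p m`!)%:R.
Proof.
have small p : prime p -> (m < p)%N -> logn p m`! = 0%N.
  by move=> pp mp; apply/eqP; rewrite -leqn0 leqNgt logn_gt0 mem_primes pp fact_gt0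
    (negPf (prime_ndvd_fact _ _ pp mp)).
have mf : (m <= m`!)%N by case: m {small} => // m; rewrite factS leq_pmulr ?fact_gt0.
(* The factorization is first written over primes up to [m]!, then cut at [m], beyond which all
   exponents vanish. *)
rewrite {1}(@prod_logn m`! m`!) ?fact_gt0 ?leqnn //.
rewrite lnn_prod; last by move=> p pp; rewrite expn_gt0 prime_gt0.
rewrite (@big_cat_nat _ _ _ m.+1) //= [X in _ + X]big_nat_cond.
rewrite [X in _ + X]big1 ?addr0; last first.
  by move=> p /andP[/andP[mp _] pp]; rewrite small // expn0 ln1.
apply: eq_bigr => p pp; rewrite natrX lnXn ?mulr_natr //.
by rewrite ltr0n prime_gt0.
Qed.

Lemma lnn_succ n : (0 < n)%N -> n%:R * (lnn n.+1 - lnn n) <= 1.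
Proof.
move=> n0; have n0' : 0 < n%:R :> R by rewrite ltr0n.
rewrite -ln_div ?posrE ?ltr0n // -natr1 mulrDl mulfV ?gt_eqF // mul1r.
have := @le_ln1Dx R n%:R^-1; rewrite -ler_pdivlMl // mulr1; apply.
by rewrite (@lt_trans _ _ 0) ?invr_gt0 // oppr_lt0.
Qed.

Lemma lnn_fact_ge n : n%:R * lnn n - n%:R <= lnn n`!.
Proof.
elim: n => [|n IH]; first by rewrite mul0r subrr lnn_ge0.
rewrite factS natrM lnM ?posrE ?ltr0n ?fact_gt0 // -lerBlDl.
apply: le_trans IH; case: n => [|n]; first by rewrite ln1; lra.
have := lnn_succ n.+1 isT; set a := lnn n.+2; set b := lnn n.+1.
by rewrite -(natr1 n.+1); lra.
Qed.

Lemma lnn_fact_le n : lnn n`! <= n%:R * lnn n.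
Proof.
elim: n => [|n IH]; first by rewrite mul0r ln1.
rewrite factS natrM lnM ?posrE ?ltr0n ?fact_gt0 // -natr1 mulrDl mul1r addrC lerD2r.
apply: le_trans IH _; case: n => [|n]; first by rewrite !mul0r.
by rewrite natr1 ler_pM2l ?ltr0n // ler_ln ?posrE ?ltr0n // ler_nat.
Qed.

(** Stirling's lower bound for ln n! is compared with Legendre's exponents, each at most n / (p -
    1). *)
Lemma sum_ln_div_pred_ge n : (0 < n)%N ->
  lnn n - 1 <= \sum_(0 <= p < n.+1 | prime p) lnn p / p.-1%:R.
Proof.
move=> n0; have n0' : 0 < n%:R :> R by rewrite ltr0n.
rewrite -(ler_pM2l n0') mulrBr mulr1; apply: le_trans (lnn_fact_ge n) _.
rewrite lnn_fact mulr_sumr; apply: ler_sum => p pp.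
rewrite mulrCA ler_wpM2l ?lnn_ge0 // ler_pdivlMr ?ltr0n -?subn1 ?subn_gt0 ?prime_gt1 //.
by rewrite -natrM ler_nat mulnC subn1 logn_fact_le.
Qed.

(** The exponent of p in n! exceeds n / p - 1; the terms - 1 cost the sum of ln p, which the
    primorial bound controls. *)
Lemma sum_ln_div_le n : (0 < n)%N ->
  \sum_(0 <= p < n.+1 | prime p) lnn p / p%:R <= lnn n + ln 4.
Proof.
move=> n0; have n0' : 0 < n%:R :> R by rewrite ltr0n.
rewrite -(ler_pM2l n0') mulr_sumr.
have theta : \sum_(0 <= p < n.+1 | prime p) lnn p <= n%:R * ln 4.
  rewrite -(@lnn_prod _ _ id) => [|p pp]; last exact: prime_gt0.
  rewrite mulr_natl -lnXn // -natrX ler_ln ?posrE ?ltr0n ?expn_gt0 ?ler_nat ?primorial_le //.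
  by rewrite prodn_cond_gt0 // => p pp; apply: prime_gt0.
rewrite mulrDr; apply: le_trans (lerD (lnn_fact_le n) theta).
rewrite lnn_fact -big_split /=; apply: ler_sum => p pp.
have p0 : 0 < p%:R :> R by rewrite ltr0n prime_gt0.
rewrite mulrCA -[X in _ <= _ + X]mulr1 -mulrDr ler_wpM2l ?lnn_ge0 //.
rewrite ler_pdivrMr // natr1 -natrM ler_nat.
apply: leq_trans (leq_mul (_ : (n %/ p).+1 <= _)%N (leqnn p)).
  by rewrite ltnW // ltn_ceil // prime_gt0.
by rewrite ltnS logn_fact_ge.
Qed.

(* The telescoping majorant of [ln n / (n (n - 1))] is the increment of
   [- (ln n + 2) / n]. *)
Lemma sum_ln_div_mul_le n :
  \sum_(2 <= k < n.+2) lnn k / (k%:R * k.-1%:R) <= 2 - (lnn n.+1 + 2) / n.+1%:R.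
Proof.
elim: n => [|n IH]; first by rewrite big_geq // ln1; lra.
rewrite big_nat_recr //=; apply: le_trans (lerD IH (lexx _)) _.
rewrite -addrA lerD2l.
have := lnn_succ n.+1 isT; set a := lnn n.+1; set b := lnn n.+2 => h.
have -> : n.+2%:R = n.+1%:R + 1 :> R by rewrite natr1.
have : 1 <= n.+1%:R :> R by rewrite ler1n.
move: h; set c := n.+1%:R => h c1.
rewrite -subr_ge0.
have -> : - ((b + 2) / (c + 1)) - (- ((a + 2) / c) + b / ((c + 1) * c)) =
   ((c + 1) * a + 2 - (c + 1) * b) / ((c + 1) * c) by field; apply/andP; split; lra.
apply: divr_ge0; last by apply: mulr_ge0; lra.
suff : b - a <= 1 by lra.
have ba : 0 <= b - a by rewrite subr_ge0 ler_ln ?posrE ?ltr0n // ler_nat.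
apply: le_trans h; rewrite ler_peMl //.
Qed.

(** The 5 is 1 from Stirling, 2 from replacing p - 1 by p, and 2 for ln 4 in the upper bound on the
    primes below [z]. *)
Lemma mertens_lower y z : (0 < y)%N -> (0 < z <= y.+1)%N ->
  lnn y - lnn z - 5 <= \sum_(z <= p < y.+1 | prime p) lnn p / p%:R.
Proof.
move=> y0 /andP[z0 zy].
have ln4 : ln 4 <= 2 :> R.
  rewrite -ler_expR lnK ?posrE // (_ : 2 = 1 + 1) // expRD.
  have := expR_ge1Dx (1 : R); nra.
have A := sum_ln_div_pred_ge y y0.
(* Since 1 / (p - 1) - 1 / p = 1 / (p (p - 1)), the change is dominated by a convergent sum over all
   integers k >= 2. *)
have B : \sum_(0 <= p < y.+1 | prime p) lnn p / p.-1%:R <=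
    \sum_(0 <= p < y.+1 | prime p) lnn p / p%:R + 2.
  rewrite -lerBlDl -sumrB.
  apply: le_trans (_ : \sum_(2 <= k < y.+2) lnn k / (k%:R * k.-1%:R) <= _); last first.
    apply: le_trans (sum_ln_div_mul_le _) _; rewrite gerBl divr_ge0 // addr_ge0 //.
    exact: lnn_ge0.
  rewrite big_ltn_cond // big_ltn_cond //= big_mkcond [leRHS]big_nat_recr //=.
  rewrite -[leLHS]addr0 lerD //; last first.
    by rewrite divr_ge0 ?lnn_ge0 // mulr_ge0.
  rewrite big_nat_cond [leRHS]big_nat_cond; apply: ler_sum => p /andP[/andP[p2 _] _].
  have t0 : 0 <= lnn p / (p%:R * p.-1%:R) by rewrite divr_ge0 ?lnn_ge0 // mulr_ge0.
  case: ifP => // pp; case: p p2 t0 pp => [|[|p]] //= _ _ _.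
  have -> : p.+2%:R = p.+1%:R + 1 :> R by rewrite natr1.
  have : 0 < p.+1%:R :> R by rewrite ltr0n.
  move: (p.+1%:R) (ln _) => c l c0.
  rewrite le_eqVlt; apply/orP; left; apply/eqP; field.
  by apply/andP; split; lra.
have C : \sum_(0 <= p < z | prime p) lnn p / p%:R <= lnn z + ln 4.
  case: z z0 zy => [//|[|z]] _ _.
    rewrite big_mkcond big_nat1 /= ln1; have := lnn_ge0 4; lra.
  apply: le_trans (sum_ln_div_le z.+1 isT) _; rewrite lerD2r.
  by rewrite ler_ln ?posrE ?ltr0n // ler_nat.
move: B; rewrite (@big_cat_nat _ _ _ z 0 y.+1 prime (fun p => _ / p%:R)) //=.
move=> B; lra.
Qed.
End Mertens.

(** * Lower bounds for the number of smooth integers *)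

Section SmoothLowerBound.
Context {R : realType}.
Implicit Types (c q : R).
Local Notation lnn n := (ln (n%:R : R)).

(** As the quotient is at least 1, rounding down loses at most a factor 2. *)
Lemma divn_ge_half n d : (0 < d <= n)%N -> n%:R / (2 * d%:R) <= (n %/ d)%:R :> R.
Proof.
move=> /andP[d0 dn]; have d0' : 0 < d%:R :> R by rewrite ltr0n.
rewrite ler_pdivrMr ?mulr_gt0 // -!natrM ler_nat.
have := divn_eq n d; have := ltn_mod n d; rewrite d0 => r1 r2.
have : (0 < n %/ d)%N by rewrite divn_gt0.
by move: r1 r2; move: (n %/ d)%N (n %% d)%N => u v; nia.
Qed.

(** Divide by [y] up to [J] times until [N] drops below [y], losing a factor [c] each time. The
    fixed bound [X] keeps [M] the same throughout. *)
Lemma psi_ge_crude {y M X J N : nat} {c} : (1 < y)%N -> (X < 2 ^ M.+1)%N ->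
  0 <= c <= 1 -> 2 * y%:R * M%:R * c <= (\sum_(2 <= p < y.+1 | prime p) 1)%N%:R ->
  (N <= X)%N -> (N < y ^ J)%N -> N%:R * c ^+ J <= (psi y N)%:R.
Proof.
move=> y1 XM /andP[c0 c1] hc; elim: J N => [|J IH] N NX NJ.
  by move: NJ; rewrite expn0 ltnS leqn0 => /eqP ->; rewrite mul0r.
have [Ny|yN] := ltnP N y.
  by rewrite psi_small 1?ltnW // ler_piMr // exprn_ile1.
have M0 : (0 < M)%N by case: M XM {hc} => // h; lia.
have := IH (N %/ y)%N; rewrite ltn_divLR; last by lia.
rewrite -expnSr => /(_ (leq_trans (leq_div _ _) NX) NJ) IHN.
have := @psi_div_mul_le y _ _ (leq_ltn_trans NX XM); rewrite -(ler_nat R) !natrM => h.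
have M0' : 0 < M%:R :> R by rewrite ltr0n.
rewrite -(ler_pM2l M0'); apply: le_trans h.
have y0 : 0 < y%:R :> R by rewrite ltr0n; lia.
apply: le_trans (ler_pM _ _ hc IHN); rewrite ?mulr_ge0 ?exprn_ge0 //.
have : (N%:R : R) <= 2 * y%:R * (N %/ y)%:R.
  have := divn_ge_half N y; rewrite yN ltnW // => /(_ isT).
  by rewrite ler_pdivrMr ?mulr_gt0 // mulrC.
move/(ler_wpM2r (_ : 0 <= M%:R * c ^+ J.+1)) => /(_ _).
rewrite exprS => H; apply: le_trans (_ : _ <= N%:R * (M%:R * (c * c ^+ J))) _.
  by rewrite le_eqVlt; apply/orP; left; apply/eqP; ring.
apply: le_trans (H _) _; first by rewrite !mulr_ge0 // exprn_ge0.
by rewrite le_eqVlt; apply/orP; left; apply/eqP; ring.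
Qed.

(** Each of [k] steps divides [N] by a prime in [z, y] and loses a factor [q]. The two-sided
    condition on [N] passes to [N %/ p] with [k] lowered by one; at [k = 0] the cofactor is below
    [y ^ J] and the crude bound takes over. *)
Lemma psi_ge {y z M M2 X J k N : nat} {c q} : (1 < y)%N -> (1 < z <= y)%N ->
  (X < 2 ^ M.+1)%N -> (X < z ^ M2.+1)%N ->
  0 <= c <= 1 -> 2 * y%:R * M%:R * c <= (\sum_(2 <= p < y.+1 | prime p) 1)%N%:R ->
  0 <= q -> 2 * M2%:R * q <= \sum_(z <= p < y.+1 | prime p) p%:R^-1 ->
  (N <= X)%N -> (y ^ k <= N < z ^ k * y ^ J)%N ->
  N%:R * c ^+ J * q ^+ k <= (psi y N)%:R.
Proof.
move=> y1 /andP[z1 zy] XM XM2 c01 hc q0 hq.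
have c0 : 0 <= c by case/andP: c01.
elim: k N => [|k IH] N NX /andP[yN Nz].
  by rewrite mulr1; apply: (psi_ge_crude y1 XM c01 hc NX); rewrite mul1n in Nz.
have yk0 : (0 < y ^ k)%N by rewrite expn_gt0; lia.
have yleN : (y <= N)%N by apply: leq_trans yN; rewrite expnS leq_pmulr.
have M0 : (0 < M2)%N by case: M2 XM2 {hq} => // h; lia.
have M0' : 0 < M2%:R :> R by rewrite ltr0n.
have := sum_psi_div_le (leqnn y) (leq_ltn_trans NX XM2).
rewrite -(ler_nat R) natrM natr_sum => h.
rewrite -(ler_pM2l M0'); apply: le_trans h.
set w := N%:R * c ^+ J * q ^+ k.
have w0 : 0 <= w by rewrite !mulr_ge0 // exprn_ge0.
apply: le_trans (_ : _ <= w / 2 * \sum_(z <= p < y.+1 | prime p) p%:R^-1) _.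
  apply: le_trans (ler_wpM2l _ hq); last by rewrite divr_ge0.
  by rewrite le_eqVlt; apply/orP; left; apply/eqP; rewrite /w exprS; field.
rewrite mulr_sumr [leLHS]big_nat_cond [leRHS]big_nat_cond; apply: ler_sum.
move=> p /andP[/andP[zp py] pp]; have p0 := prime_gt0 pp.
apply: le_trans (IH _ _ _); first last.
- apply/andP; split.
    rewrite leq_divRL //; apply: leq_trans yN; rewrite expnSr leq_mul2l.
    by apply/orP; right.
  rewrite ltn_divLR //; apply: leq_trans Nz _; rewrite expnSr -!mulnA leq_mul2l.
  by apply/orP; right; rewrite mulnC leq_mul2l; apply/orP; right.
- exact: leq_trans (leq_div _ _) NX.
rewrite -[leRHS]mulrA (_ : w / 2 / p%:R = N%:R / (2 * p%:R) * (c ^+ J * q ^+ k)).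
  apply: ler_wpM2r; first by rewrite mulr_ge0 // exprn_ge0.
  by apply: divn_ge_half; rewrite p0 (leq_trans _ yleN).
by rewrite /w; field; rewrite pnatr_eq0 -lt0n.
Qed.

(** With [z] near y / 2000, Mertens gives a sum of ln p / p of at least 1 over [z, y], while each
    term is at most ln y / z. *)
Lemma prime_count_ge y : (2000 <= y)%N ->
  y%:R / (2000 * lnn y) <= (\sum_(2 <= p < y.+1 | prime p) 1)%N%:R.
Proof.
move=> y2; set z := (y %/ 2000).+1.
have z2 : (1 < z)%N by rewrite /z ltnS divn_gt0.
have zy : (1000 * z <= y)%N.
  have := leq_trunc_div y 2000; move: z2; rewrite /z; lia.
have yz : (y < z * 2000)%N by rewrite ltn_ceil.
have y0n : (0 < y)%N by apply: leq_trans y2.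
move: z z2 zy yz => z z2 zy yz.
have y0 : 0 < y%:R :> R by rewrite ltr0n.
have z0 : 0 < z%:R :> R by rewrite ltr0n ltnW.
have Y0 : 0 < lnn y by rewrite ln_gt0 // ltr1n (leq_trans _ y2).
have mert := @mertens_lower R y z y0n.
have zy' : (z <= y)%N by apply: leq_trans zy; rewrite leq_pmull.
have {}mert := mert (introT andP (conj (ltnW z2) (leqW zy'))).
(* From e <= (8 / 7) ^ 8 <= 3 follows e ^ 6 <= 3 ^ 6 <= 1000 <= y / z; the 6 covers the error 5 in
   Mertens and leaves 1. *)
have : 6 <= lnn y - lnn z.
  rewrite -ln_div ?posrE // -ler_expR lnK ?posrE ?divr_gt0 //.
  apply: le_trans (_ : 1000 <= _); last by rewrite ler_pdivlMr // -natrM ler_nat.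
  rewrite -[6](mulr1) expRM_natl.
  apply: le_trans (_ : 3 ^+ 6 <= _); last by lra.
  rewrite lerXn2r ?nnegrE ?expR_ge0 //.
  have := expR_ge1Dx (- 8^-1 : R); rewrite expRN => h.
  have {}h : expR (8^-1) <= 8 / 7 :> R.
    rewrite -[leLHS]invrK -[leRHS]invrK lef_pV2 ?posrE ?invr_gt0 ?expR_gt0 //; lra.
  rewrite -[1](mulfV (_ : 8 != 0 :> R)) // expRM_natl.
  apply: le_trans (_ : (8 / 7) ^+ 8 <= _); last by lra.
  by rewrite lerXn2r ?nnegrE ?expR_ge0.
move=> ln6; have {mert}mert : 1 <= \sum_(z <= p < y.+1 | prime p) lnn p / p%:R.
  by apply: le_trans mert; lra.
have Y2 : 0 < 2000 * lnn y by rewrite mulr_gt0 ?ltr0n.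
rewrite (ler_pdivrMr _ _ Y2).
have : 1 <= (\sum_(z <= p < y.+1 | prime p) 1)%N%:R * (lnn y / z%:R).
  apply: le_trans mert _; rewrite natr_sum mulr_suml.
  rewrite big_nat_cond [leRHS]big_nat_cond; apply: ler_sum => p /andP[/andP[zp py] pp].
  rewrite mul1r; apply: ler_pM; rewrite ?lnn_ge0 ?invr_ge0 ?ler0n //.
    by rewrite ler_ln ?posrE // ?ler_nat // ltr0n prime_gt0.
  by rewrite lef_pV2 ?posrE ?ler_nat // ltr0n prime_gt0.
rewrite mulrA ler_pdivlMr // mul1r => h.
have sub : (\sum_(z <= p < y.+1 | prime p) 1 <= \sum_(2 <= p < y.+1 | prime p) 1)%N.
  by rewrite [leqRHS](@big_cat_nat _ _ _ z) ?leq_addl // leqW.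
move: sub yz; rewrite -(ler_nat R) -(ltr_nat R) natrM => sub yz.
have := ler_wpM2r (ltW Y0) sub; nra.
Qed.

(* With [u = ln N / ln y], the two factors are the loss [(ln N)^(delta u)] on a
   cofactor of size about [y^(delta u)] and the main loss [u^u]. *)
Lemma psi_ge_exp {delta : R} {y N : nat} : 0 < delta <= 2^-1 ->
  (2000 <= y <= N)%N -> 12 <= delta * lnn y ->
  N%:R * expR (- ((delta * (lnn N / lnn y) + 2) * ln (4 * 2000 * lnn y * lnn N) +
                 lnn N / lnn y * ln (8 * lnn N / (delta * lnn y)))) <= (psi y N)%:R.
Proof.
move=> /andP[d0 d1] /andP[y2 yN] dY.
have y1 : (1 < y)%N by apply: leq_trans y2.
have y0n := ltnW y1; have N0n := leq_trans y0n yN.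
have y0 : 0 < y%:R :> R by rewrite ltr0n.
have N0 : 0 < N%:R :> R by rewrite ltr0n.
have := prime_count_ge y y2; clear y2.
have : 1 <= 2000 :> R by rewrite ler1n.
move: (2000 : R) => K K1 pc.
set Y := lnn y in dY pc *; set l := lnn N.
have Y1 : 24 <= Y by nra.
have Yl : Y <= l by rewrite /Y /l ler_ln ?posrE // ler_nat.
have eY : expR Y = y%:R by rewrite lnK.
have el : expR l = N%:R by rewrite lnK.
(* [e] is y ^ (1 - delta), and [z] is the next integer. *)
set e := expR ((1 - delta) * Y).
have e1 : 1 <= e by rewrite -expR0 ler_expR mulr_ge0 //; lra.
set z := (Num.truncn e).+1.
have /andP[ze0 ze1] := truncn_itv (le_trans ler01 e1 : 0 <= e).
have zy : (1 < z <= y)%N.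
  rewrite /z !ltnS truncn_gt0 e1 /= truncn_lt_nat ?expR_ge0 // -eY ltr_expR.
  by rewrite -subr_gt0 (_ : _ - _ = delta * Y); [lra | ring].
have ze2 : z%:R <= 2 * e by rewrite /z -natr1; lra.
have z0 : 0 < z%:R :> R by rewrite ltr0n.
(* [k] is the integer part of u, and [J] exceeds delta k + 1, so that N < y ^ (k + 1) <= z ^ k y ^
   J. *)
set k := trunc_log y N; set J := (Num.truncn (delta * k%:R)).+2.
have dk0 : 0 <= delta * k%:R by rewrite mulr_ge0 // ltW.
have /andP[J0 J1] := truncn_itv dk0.
have kl : k%:R * Y <= l.
  rewrite -ler_expR expRM_natl eY el -natrX ler_nat.
  exact: trunc_logP.
set M := trunc_log 2 N; set M2 := trunc_log z N.
have Ml : M%:R <= 2 * l.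
  have : M%:R * 2^-1 <= l.
    rewrite -ler_expR expRM_natl el.
    apply: le_trans (_ : 2 ^+ M <= _); last first.
      by rewrite -natrX ler_nat; apply: trunc_logP.
    rewrite lerXn2r ?nnegrE ?expR_ge0 //.
    have := expR_ge1Dx (- 2^-1 : R); rewrite expRN => h.
    rewrite -[leLHS]invrK -[leRHS]invrK lef_pV2 ?posrE ?invr_gt0 ?expR_gt0 //; lra.
  by lra.
have M2l : M2%:R * Y <= 2 * l.
  have : M2%:R * ((1 - delta) * Y) <= l.
    rewrite -ler_expR expRM_natl el.
    apply: le_trans (_ : z%:R ^+ M2 <= _); last first.
      by rewrite -natrX ler_nat; apply: trunc_logP; case/andP: zy.
    by rewrite lerXn2r ?nnegrE ?expR_ge0 // ltW.
  have := ler0n R M2; nra.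
(* These are the values allowed by [M] <= 2 l, [M2] <= 2 l / Y, at least y / (K Y) primes up to [y],
   and a sum of 1 / p over [z, y] of at least delta / 2. *)
set c := (4 * K * Y * l)^-1; set q := (8 * l / (delta * Y))^-1.
have cpos : 0 < 4 * K * Y * l by rewrite !mulr_gt0 //; lra.
have c1 : 1 <= 4 * K * Y * l.
  have : 1 <= 4 * K * Y by nra.
  nra.
have dYpos : 0 < delta * Y by lra.
have qpos : 0 < 8 * l / (delta * Y) by rewrite divr_gt0 // mulr_gt0 //; lra.
have q1 : 1 <= 8 * l / (delta * Y) by rewrite ler_pdivlMr // mul1r; nra.
apply: le_trans (_ : _ <= N%:R * c ^+ J * q ^+ k) _; last first.
  apply: (@psi_ge y z M M2 N J k N c q) => //.
  - exact: trunc_log_ltn.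
  - by apply: trunc_log_ltn; case/andP: zy.
  - by rewrite invr_ge0 ltW //= invf_le1.
  - apply: le_trans pc; rewrite ler_pdivlMr; last by rewrite mulr_gt0 //; lra.
    have -> : 2 * y%:R * M%:R * c * (K * Y) = y%:R * (M%:R * (2 * K * Y * c)) by ring.
    rewrite ler_piMr // (le_trans (ler_wpM2r _ Ml)) //.
      by rewrite !mulr_ge0 ?invr_ge0 ?ltW //; lra.
    have -> : 2 * l * (2 * K * Y * c) = c * (4 * K * Y * l) by ring.
    by rewrite /c mulVf // gt_eqF.
  - by rewrite /q invr_ge0 ltW.
  - apply: le_trans (_ : delta / 2 <= _).
      rewrite /q invf_div mulrA ler_pdivrMr; last by lra.
      have -> : 2 * M2%:R * (delta * Y) = 2 * delta * (M2%:R * Y) by ring.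
      have -> : delta / 2 * (8 * l) = 2 * delta * (2 * l) by field.
      by rewrite ler_wpM2l //; lra.
    (* Bound 1 / p below by ln p / (p Y); Mertens then gives delta Y - 6, which is at least delta Y
       / 2 as delta Y >= 12. *)
    have Y0 : 0 < Y by lra.
    rewrite -(ler_pM2l Y0) mulr_sumr.
    apply: le_trans (_ : Y - lnn z - 5 <= _).
      have : lnn z <= 1 + (1 - delta) * Y.
        rewrite -ler_expR lnK ?posrE // expRD; apply: le_trans ze2 _.
        rewrite ler_wpM2r ?expR_ge0 //; have := expR_ge1Dx (1 : R); lra.
      by nra.
    apply: le_trans (@mertens_lower R y z y0n _) _.
      by case/andP: zy => /ltnW -> /leqW.
    rewrite [leLHS]big_nat_cond [leRHS]big_nat_cond; apply: ler_sum.
    move=> p /andP[/andP[_ py] pp]; rewrite ler_wpM2r ?invr_ge0 //.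
    have p0 : 0 < p%:R :> R by rewrite ltr0n prime_gt0.
    by rewrite /Y ler_ln ?posrE // ler_nat.
  - apply/andP; split; first exact: trunc_logP.
    apply: leq_trans (trunc_log_ltn _ y1) _; rewrite -(ler_nat R) natrM !natrX.
    apply: le_trans (_ : e ^+ k * y%:R ^+ J <= _); last first.
      by rewrite ler_wpM2r ?exprn_ge0 // lerXn2r ?nnegrE ?expR_ge0 // ltW.
    rewrite -eY /e -!expRM_natl -expRD ler_expR -natr1.
    have : delta * k%:R + 1 <= J%:R by rewrite /J -natr1; lra.
    have Y0 : 0 <= Y by lra.
    move/(ler_wpM2r Y0); lra.
rewrite -[leRHS]mulrA ler_pM2l //.
rewrite opprD expRD; apply: ler_pM; rewrite ?expR_ge0 //.
  rewrite /c -[X in _ <= X^-1 ^+ _](lnK (_ : _ \in Num.pos)) ?posrE //.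
  rewrite -expRN -expRM_natl ler_expR mulrN lerN2.
  rewrite ler_wpM2r ?ln_ge0 // /J -addn2 natrD; apply: lerD => //.
  apply: le_trans J0 _; rewrite ler_wpM2l ?(ltW d0) //.
  by rewrite ler_pdivlMr //; lra.
rewrite /q -[X in _ <= X^-1 ^+ _](lnK (_ : _ \in Num.pos)) ?posrE //.
rewrite -expRN -expRM_natl ler_expR mulrN lerN2.
by rewrite ler_wpM2r ?ln_ge0 // ler_pdivlMr //; lra.
Qed.
End SmoothLowerBound.

(** This lets the [n] up to [m] be discarded: the final bound on [tn n] is in terms of ln n, not ln
    x, and needs [n] large. *)
Lemma count_le_add (P Q : pred nat) m N :
  (forall n, (m < n)%N -> Q n -> P n) ->
  (count Q (iota 1 N) <= count P (iota 1 N) + m)%N.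
Proof.
move=> QP; apply: (@leq_trans (count P (iota 1 N) + count (fun n => n <= m)%N (iota 1 N))).
  rewrite -count_predUI; apply: leq_trans (leq_addr _ _); apply: sub_count => n /= Qn.
  by case: leqP => nm; rewrite ?orbT // QP.
rewrite leq_add2l -size_filter -[leqRHS](size_iota 1); apply: uniq_leq_size.
  by rewrite filter_uniq ?iota_uniq.
by move=> n; rewrite mem_filter !mem_iota; lia.
Qed.

(** * Asymptotic comparison of log x, loglog x and log L *)

Section Asymptotics.
Context {R : realType}.
Implicit Types (B x : R).
Local Notation s := (Num.sqrt 2 : R).

(** [l], [v], [T] stand for log x, loglog x and log L. The single parameter [B] separates them, so
    that every largeness condition becomes a choice of [B]. *)
Definition scales B (l v T : R) : Prop :=
  [/\ B <= v, B * v <= T, B * T <= l, T ^+ 2 = l * v & expR v = l].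

Lemma eventually_scales B : 1 <= B -> exists x0 : R, forall x, x0 <= x ->
  expR (ln x) = x /\ scales B (ln x) (ln (ln x)) (Num.sqrt (ln x * ln (ln x))).
Proof.
move=> B1; exists (expR (expR (2 * B ^+ 2))) => x xx0.
have x0 : 0 < x by apply: lt_le_trans xx0; apply: expR_gt0.
have xl : expR (ln x) = x by rewrite lnK.
split=> //; set l := ln x in xl *.
have ll : expR (2 * B ^+ 2) <= l by rewrite -ler_expR xl.
have l0 : 0 < l by apply: lt_le_trans ll; apply: expR_gt0.
have lv : expR (ln l) = l by rewrite lnK.
set v := ln l in lv *.
have vB : 2 * B ^+ 2 <= v by rewrite -ler_expR lv.
have v0 : 0 <= v by nra.
(* l = e ^ v >= v ^ 2 / 2, and v >= 2 B ^ 2. *)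
have lBv : B ^+ 2 * v <= l.
  have := @expR_ge1Dxn R v 1 v0; rewrite lv (_ : 2`! = 2)%N // => h; nra.
have lv0 : 0 <= l * v by rewrite mulr_ge0 // ltW.
set T := Num.sqrt (l * v).
have T2 : T ^+ 2 = l * v by rewrite sqr_sqrtr.
have T0 : 0 <= T by apply: sqrtr_ge0.
split => //; first by nra.
  rewrite -(@ler_pXn2r _ 2) ?nnegrE //; last by apply: mulr_ge0 => //; lra.
  by rewrite T2 (_ : (B * v) ^+ 2 = B ^+ 2 * v * v); [rewrite ler_wpM2r | ring].
rewrite -(@ler_pXn2r _ 2) ?nnegrE ?(ltW l0) //; last by apply: mulr_ge0 => //; lra.
rewrite exprMn T2 (_ : B ^+ 2 * (l * v) = l * (B ^+ 2 * v)); last by ring.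
by rewrite [l ^+ 2]expr2 ler_wpM2l // ltW.
Qed.

Lemma sqrt2_bounds : 14 / 10 <= s <= 15 / 10.
Proof.
have s2 : s ^+ 2 = 2 by rewrite sqr_sqrtr.
have s0 : 0 <= s by apply: sqrtr_ge0.
by apply/andP; split; nra.
Qed.

(** For u = [lN / Y], the lower bound on [Y] gives u v <= s l v / ((1 - delta) T) = s T / (1 -
    delta), and 1 / (1 - delta) <= 1 + 2 delta. *)
Lemma smoothness_ratio_le {delta l v T Y lN : R} : 0 < delta <= 2^-1 ->
  0 <= v -> 0 < T -> T ^+ 2 = l * v -> (1 - delta) * T <= s * Y ->
  0 < Y -> 0 <= lN <= l -> lN / Y * v <= s * (1 + 2 * delta) * T.
Proof.
move=> /andP[d0 d1] v0 T0 T2 YT Y0 /andP[lN0 ll].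
set r := lN / Y; have rY : r * Y = lN by rewrite mulfVK // gt_eqF.
have r0 : 0 <= r by rewrite divr_ge0 // ltW.
have s0 : 0 <= s by apply: sqrtr_ge0.
have h1 : r * ((1 - delta) * T) <= s * l.
  by apply: le_trans (ler_wpM2l r0 YT) _; rewrite mulrCA rY ler_wpM2l.
have h2 : r * v * (1 - delta) <= s * T.
  rewrite -(ler_pM2r T0).
  rewrite (_ : r * v * (1 - delta) * T = r * ((1 - delta) * T) * v); last by ring.
  rewrite (_ : s * T * T = s * l * v); first by rewrite ler_wpM2r.
  by rewrite -!mulrA -expr2 T2.
have rv0 : 0 <= r * v by rewrite mulr_ge0.
clear YT T2 rY r0 ll.
have h3 : r * v * (1 - delta) * (1 + 2 * delta) <= s * T * (1 + 2 * delta).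
  by rewrite ler_wpM2r //; lra.
have dd : delta * delta <= delta * 2^-1 by rewrite ler_wpM2l // ltW.
have h4 : r * v <= r * v * ((1 - delta) * (1 + 2 * delta)).
  by rewrite ler_peMr //; lra.
by rewrite mulrA in h4; rewrite [leRHS]mulrAC; apply: le_trans h4 h3.
Qed.

Lemma ln_prod3_le {K l v Y lN : R} : 0 < K -> 4 * K <= l -> 0 < Y <= l ->
  0 < lN <= l -> expR v = l -> ln (4 * K * Y * lN) <= 3 * v.
Proof.
move=> K0 Kl /andP[Y0 Yl] /andP[lN0 ll] lv.
have K4 : 0 < 4 * K by rewrite mulr_gt0.
have KY : 0 < 4 * K * Y by rewrite mulr_gt0.
rewrite -ler_expR lnK ?posrE; last by rewrite mulr_gt0.
rewrite expRM_natl lv (_ : l ^+ 3 = l * l * l); last by ring.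
by apply: ler_pM => //; [exact: ltW | exact: ltW | apply: ler_pM => //; exact: ltW].
Qed.

(** [r] is at most 3 T / v <= 3 sqrt l = 3 e ^ (v / 2), which explains the 1 / 2; the constants 24 /
    delta are absorbed by e ^ (delta v). *)
Lemma ln_ratio_le {delta l v T r : R} : 0 < delta <= 2^-1 ->
  1 <= v -> 0 <= T -> T ^+ 2 = l * v -> expR v = l -> 24 <= delta * (delta * v) ->
  0 < r -> r * v <= 3 * T -> ln (8 * r / delta) <= (2^-1 + delta) * v.
Proof.
move=> /andP[d0 d1] v1 T0 T2 lv ddv r0 rv.
have v0 : 0 < v by apply: lt_le_trans v1.
have r80 : 0 < 8 * r by rewrite mulr_gt0.
rewrite -ler_expR lnK ?posrE ?divr_gt0 //.
rewrite (_ : 8 * r / delta = r * (8 / delta)); last by field; rewrite gt_eqF.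
rewrite (mulrDl 2^-1 delta v) expRD.
set h := expR (2^-1 * v).
have h2 : h ^+ 2 = l by rewrite -expRM_natl mulrA mulfV // mul1r.
have h0 : 0 <= h by apply: expR_ge0.
have vh0 : 0 <= v * h by rewrite mulr_ge0 // ltW.
have Th : T <= v * h.
  rewrite -(@ler_pXn2r _ 2) ?nnegrE //.
  rewrite T2 exprMn h2 mulrC expr2 ler_wpM2r // -?lv ?expR_ge0 //.
  by rewrite ler_peMr // ltW.
have rh : r <= h * 3.
  by rewrite -(ler_pM2r v0); apply: le_trans rv _; clear -Th; lra.
have ed : 24 / delta <= expR (delta * v).
  apply: le_trans (expR_ge1Dx _); rewrite ler_pdivrMr //.
  by rewrite mulrDl mul1r mulrC; apply: le_trans ddv _; rewrite lerDr ltW.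
have d8 : 0 <= 8 / delta by rewrite divr_ge0 // ltW.
apply: le_trans (ler_pM (ltW r0) d8 rh (lexx _)) _.
rewrite -mulrA ler_wpM2l // (le_trans _ ed) // mulrA.
by rewrite ler_pM2r ?invr_gt0 // -natrM.
Qed.

(** The main term is r v / 2, about s T / 2. The first logarithm adds 3 delta r v + 6 v, and the
    second an error delta r v. *)
Lemma exponent_le {delta K l v T Y lN : R} : 0 < delta <= 2^-1 ->
  100 <= K -> 4 * K <= delta * (delta * v) -> 1 <= v -> 6 * v <= delta * T ->
  T <= l -> T ^+ 2 = l * v -> expR v = l -> 4 * K <= l ->
  (1 - delta) * T <= s * Y -> 0 < Y <= T -> Y <= lN <= l ->
  (delta * (lN / Y) + 2) * ln (4 * K * Y * lN) +
    lN / Y * ln (8 * lN / (delta * Y)) <= (s / 2 + 15 * delta) * T.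
Proof.
move=> d01 K100 ddv v1 vdT Tl T2 lv Kl YT /andP[Y0 YleT] /andP[YlN ll].
have /andP[d0 d1] := d01.
have lN0 : 0 < lN by apply: lt_le_trans YlN.
have T0 : 0 < T by apply: lt_le_trans YleT.
have v0 : 0 <= v by apply: le_trans v1.
have rv : lN / Y * v <= s * (1 + 2 * delta) * T.
  by apply: (smoothness_ratio_le d01 v0 T0 T2 YT Y0); rewrite ltW.
have Yl : 0 < Y <= l by rewrite Y0 (le_trans YleT).
have lNl : 0 < lN <= l by rewrite lN0.
have K0 : 0 < K by apply: lt_le_trans K100.
have ln1 := ln_prod3_le K0 Kl Yl lNl lv.
rewrite [8 * lN / _](_ : _ = 8 * (lN / Y) / delta); last first.
  by field; rewrite !gt_eqF.
set r := lN / Y in rv *.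
have r0 : 0 < r by rewrite divr_gt0.
have /andP[s14 s15] := sqrt2_bounds.
have rv3 : r * v <= 3 * T.
  apply: le_trans rv _; rewrite ler_wpM2r ?(ltW T0) //.
  by apply: le_trans (ler_pM _ _ s15 (_ : 1 + 2 * delta <= 2)) _; clear -d0 d1 s14; lra.
have ddv24 : 24 <= delta * (delta * v).
  by apply: le_trans ddv; clear -K100; lra.
have ln2 := ln_ratio_le d01 v1 (ltW T0) T2 lv ddv24 r0 rv3.
have A : (delta * r + 2) * ln (4 * K * Y * lN) <= (delta * r + 2) * (3 * v).
  by rewrite ler_wpM2l // addr_ge0 // mulr_ge0 // ltW.
have C := ler_wpM2l (ltW r0) ln2.
have D : r * v * (2^-1 + 4 * delta) <= s * (1 + 2 * delta) * T * (2^-1 + 4 * delta).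
  by rewrite ler_wpM2r // addr_ge0 // mulr_ge0 // ltW.
have E : s * (1 + 2 * delta) * (2^-1 + 4 * delta) <= s / 2 + 14 * delta.
  clear -d0 d1 s14 s15.
  have dd : delta * delta <= delta * 2^-1 by rewrite ler_wpM2l // ltW.
  have sd : s * delta <= 15 / 10 * delta by rewrite ler_wpM2r // ltW.
  have sdd : s * (delta * delta) <= 15 / 10 * (delta * delta).
    by rewrite ler_wpM2r // mulr_ge0 // ltW.
  lra.
move/(ler_wpM2r (ltW T0)): E => E; clear -A C D E vdT; lra.
Qed.

Lemma psi_ge_scales {delta l v T : R} : 0 < delta <= 2^-1 ->
  scales (4 * 2000 / delta ^+ 2) l v T ->
  expR (l - (s / 2 + 16 * delta) * T) <=
    (psi (Num.truncn (expR (T / s))) (Num.truncn (expR l)))%:R.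
Proof.
move=> /andP[d0 d1].
have PG (y N : nat) : 2000 <= y%:R :> R -> (y <= N)%N -> _ :=
  fun y2 yN => @psi_ge_exp R delta y N (introT andP (conj d0 d1))
    (introT andP (conj (etrans (esym (ler_nat R 2000 y)) y2) yN)).
move: PG; have : 100 <= 2000 :> R by rewrite ler_nat.
move: (2000 : R) => K K100 PG [Bv BvT BTl T2 lv].
have /andP[s14 s15] := sqrt2_bounds.
have s0 : 0 < s by lra.
(* [B] is chosen so that delta ^ 2 B = 4 K, whence all the conditions of [exponent_le]. *)
move: Bv BvT BTl; set B := 4 * K / delta ^+ 2 => Bv BvT BTl.
have ddB : delta * (delta * B) = 4 * K by rewrite /B; field; rewrite gt_eqF.
have dB : 8 * K <= delta * B.
  suff : delta * (8 * K) <= delta * (delta * B) by rewrite ler_pM2l.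
  by rewrite ddB; nra.
have B1 : 16 * K <= B.
  suff : delta * (16 * K) <= delta * B by rewrite ler_pM2l.
  by nra.
clearbody B.
have v1 : 16 * K <= v by lra.
have vl0 : 1 <= v by lra.
have T0 : B * B <= T by apply: le_trans BvT; rewrite ler_wpM2l //; lra.
have vT : v <= T by apply: le_trans BvT; rewrite ler_peMl; lra.
have dT : 8 * K <= delta * T.
  by apply: le_trans dB _; rewrite ler_pM2l //; lra.
have Tl : T <= l by apply: le_trans BTl; rewrite ler_peMl; lra.
have ddv : 4 * K <= delta * (delta * v) by rewrite -ddB !ler_pM2l.
have vdT : 6 * v <= delta * T.
  apply: le_trans (_ : delta * (B * v) <= _); last by rewrite ler_pM2l.
  by rewrite mulrA ler_wpM2r //; lra.
have Kl : 4 * K <= l by lra.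
clear dB ddB B1 Bv BvT BTl T0.
set a := T / s.
have as_ : a * s = T by rewrite mulfVK // gt_eqF.
have a0 : 0 <= a by rewrite divr_ge0 //; lra.
have aT : a <= T by rewrite -as_ ler_peMr //; lra.
have a1 : T <= 2 * a by rewrite -as_ mulrC ler_wpM2r //; lra.
have /andP[yle ylt] := truncn_itv (expR_ge0 a).
have /andP[Nle Nlt] := truncn_itv (expR_ge0 l).
have y2 : K <= (Num.truncn (expR a))%:R.
  move: ylt; rewrite -natr1; have := expR_ge1Dx a; lra.
have yN : (Num.truncn (expR a) <= Num.truncn (expR l))%N.
  by apply: le_truncn; rewrite ler_expR; lra.
move: yle ylt Nle Nlt y2 yN; move: (Num.truncn (expR a)) (Num.truncn (expR l)) => y N.
move=> yle ylt Nle Nlt y2 yN.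
have y0 : 0 < y%:R :> R by lra.
have N0 : 0 < N%:R :> R by apply: lt_le_trans y0 _; rewrite ler_nat.
have N1 : 1 <= N%:R :> R by rewrite ler1n -(ltr0n R).
(* Rounding down loses at most a factor 2 <= e, hence shifts ln y and ln N by at most 1. *)
have e2 : 2 <= expR 1 :> R by have := expR_ge1Dx (1 : R); lra.
have Ya : ln y%:R <= a by rewrite -ler_expR lnK.
have aY : a - 1 <= ln y%:R.
  rewrite -ler_expR lnK ?posrE // expRB ler_pdivrMr ?expR_gt0 //.
  by move: ylt; rewrite -natr1 => ylt; nra.
have ll : ln N%:R <= l by rewrite -ler_expR lnK.
have lN : expR (l - 1) <= N%:R.
  rewrite expRB ler_pdivrMr ?expR_gt0 //.
  by move: Nlt; rewrite -natr1 => Nlt; nra.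
have Yl : ln y%:R <= ln N%:R :> R by rewrite ler_ln ?posrE // ler_nat.
have := PG y N y2 yN.
move: Ya aY ll Yl; set Y := ln y%:R; set lN' := ln N%:R => Ya aY ll Yl.
have dY : 12 <= delta * Y.
  have : delta * T <= delta * (2 * (Y + 1)) by rewrite ler_pM2l //; lra.
  by clear -dT K100 d0 d1; lra.
move=> /(_ dY); apply: le_trans.
have Y0 : 0 < Y by lra.
have YT : (1 - delta) * T <= s * Y.
  have : s * (a - 1) <= s * Y by rewrite ler_wpM2l // ltW.
  by clear -as_ s15 dT K100; lra.
have YleT : 0 < Y <= T by rewrite Y0 (le_trans Ya).
have YlN : Y <= lN' <= l by rewrite Yl.
have E := exponent_le (introT andP (conj d0 d1)) K100 ddv vl0 vdT Tl T2 lv Kl YT YleT YlN.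
apply: le_trans (ler_wpM2r (expR_ge0 _) lN); rewrite -expRD ler_expR.
by clear -E dT K100; lra.
Qed.
End Asymptotics.

(** * The lower bound for the counting function *)

Section Conclusion.
Context {R : realType}.
Local Notation s := (Num.sqrt 2 : R).

(** For [m] at least x ^ (1 - e / 24), ln m and ln (ln m) each lose at most a factor 1 - e / 24. It
    remains that (s + e / 4) ^ 2 <= (2 + e) (1 - e / 24) ^ 2: to first order in e, s / 2 < 5 / 6. *)
Lemma radius_le {e l v T m : R} : 0 < e <= 2^-1 -> 0 <= T -> T ^+ 2 = l * v ->
  expR v = l -> 24 <= e * v -> expR ((1 - e / 24) * l) <= m ->
  (s + e / 4) * T <= Num.sqrt ((2 + e) * ln m * ln (ln m)).
Proof.
move=> /andP[e0 e1] T0 T2 lv ev lm.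
have l0 : 0 < l by rewrite -lv expR_gt0.
have v0 : 0 < v by rewrite -(pmulr_rgt0 _ e0); lra.
have /andP[s14 s15] := @sqrt2_bounds R.
have m0 : 0 < m by apply: lt_le_trans lm; apply: expR_gt0.
have eta0 : 0 < 1 - e / 24 by lra.
have ln1 : (1 - e / 24) * l <= ln m by rewrite -ler_expR lnK.
have ln0 : 0 < ln m by apply: lt_le_trans ln1; rewrite mulr_gt0.
have ln2 : (1 - e / 24) * v <= ln (ln m).
  rewrite -ler_expR lnK //; apply: le_trans ln1.
  rewrite mulrBl mul1r expRB lv ler_pdivrMr ?expR_gt0 // mulrAC ler_peMl ?(ltW l0) //.
  (* As e v / 24 >= 1, the power l ^ (e / 24) is at least 2 and outweighs the factor 1 - e / 24. *)
  have := expR_ge1Dx (e / 24 * v); have : 1 <= e / 24 * v by lra.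
  move: (e / 24 * v) (expR _) => a b a1 ab.
  apply: le_trans (_ : (1 - e / 24) * 2 <= _); first by lra.
  by rewrite ler_wpM2l ?(ltW eta0) //; lra.
have se0 : 0 <= (s + e / 4) * T by rewrite mulr_ge0 //; lra.
rewrite -[leLHS](ger0_norm se0) -sqrtr_sqr ler_sqrt; last first.
  rewrite !mulr_ge0 ?(ltW ln0) //; first by lra.
  by apply: le_trans ln2; rewrite mulr_ge0 // ltW.
apply: le_trans (_ : (2 + e) * ((1 - e / 24) * l * ((1 - e / 24) * v)) <= _); last first.
  rewrite -[leRHS]mulrA ler_wpM2l //; first by lra.
  by apply: ler_pM => //; rewrite mulr_ge0 // ltW.
rewrite exprMn T2.
have -> : (2 + e) * ((1 - e / 24) * l * ((1 - e / 24) * v)) =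
  ((2 + e) * (1 - e / 24) ^+ 2) * (l * v) by ring.
rewrite ler_wpM2r //; first by rewrite mulr_ge0 // ltW.
have s2 : s ^+ 2 = 2 by rewrite sqr_sqrtr.
have -> : (s + e / 4) ^+ 2 = s ^+ 2 + s * e / 2 + e * e / 16 by field.
rewrite s2; clear -e0 e1 s14 s15.
have se : s * e <= 15 / 10 * e by rewrite ler_wpM2r // ltW.
have ee : e * e <= e * 2^-1 by rewrite ler_wpM2l // ltW.
have eee : 0 <= e * e * e by rewrite !mulr_ge0 // ltW.
lra.
Qed.

Lemma count_tn_ge {e l T : R} : 0 < e <= 1 -> 160 <= e * T -> 5 * T <= l ->
  expR (l - (s / 2 + e / 8) * T) <=
    (psi (Num.truncn (expR (T / s))) (Num.truncn (expR l)))%:R ->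
  expR (l - (3 * s / 2 + 3 / 8 * e) * T) / 2 <=
    (count (fun n => tn n <= Num.truncn (expR ((s + e / 4) * T)))%N
       (iota 1 (Num.truncn (expR l))))%:R.
Proof.
move=> /andP[e0 e1] eT Tl.
have s2 : s ^+ 2 = 2 by rewrite sqr_sqrtr.
have /andP[s14 s15] := @sqrt2_bounds R.
have T0 : 0 < T by rewrite -(pmulr_rgt0 _ e0); lra.
have -> : T / s = s / 2 * T.
  have sn : s != 0 by rewrite gt_eqF //; lra.
  apply: (mulIf sn); rewrite mulfVK // (_ : s / 2 * T * s = s ^+ 2 / 2 * T); last by field.
  by rewrite s2 mulfV // mul1r.
set h := expR ((s + e / 4) * T).
have h1 : 1 <= h by rewrite -expR0 ler_expR mulr_ge0 ?(ltW T0) //; lra.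
have a1 : 1 <= expR (s / 2 * T) by rewrite -expR0 ler_expR mulr_ge0 ?(ltW T0) //; lra.
have /andP[yle _] := truncn_itv (le_trans ler01 a1).
have /andP[Nle _] := truncn_itv (expR_ge0 l).
have /andP[Hle Hlt] := truncn_itv (le_trans ler01 h1).
have H0 : (0 < Num.truncn h)%N by rewrite truncn_gt0.
move: yle Nle Hle Hlt H0.
move: (Num.truncn (expR l)) (Num.truncn h) (Num.truncn (expR (s / 2 * T))) => N H y.
move=> yle Nle Hle Hlt H0 Psi.
have := @psi_le_count_tn y H N H0; rewrite -(ler_nat R) !natrD !natrM.
set G := (count _ _)%:R => up; have {Psi up}low := le_trans Psi up.
(* Both error terms of [psi_le_count_tn] are measured by [w]: together at most 5 w, while [psi] is
   at least 10 w, so half of it survives. *)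
set w := expR (l - (s / 2 + e / 4) * T).
have H1 : 1 <= H%:R :> R by rewrite ler1n.
have q : (N %/ H)%:R * h <= 2 * expR l.
  apply: le_trans (_ : (N %/ H)%:R * (2 * H%:R) <= _).
    by rewrite ler_wpM2l //; move: Hlt; rewrite -natr1; lra.
  rewrite mulrCA ler_wpM2l // -natrM; apply: le_trans Nle.
  by rewrite ler_nat leq_trunc_div.
have w1 : (N %/ H)%:R * y.+1%:R <= 4 * w.
  have -> : w = expR l * expR (s / 2 * T) / h.
    by rewrite -expRD -expRB; congr expR; field.
  have h0 : 0 < h by lra.
  rewrite mulrA ler_pdivlMr // mulrAC.
  have -> : 4 * (expR l * expR (s / 2 * T)) = (2 * expR l) * (2 * expR (s / 2 * T)) by ring.
  apply: ler_pM => //; first by rewrite mulr_ge0 // ltW.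
  by rewrite -natr1; lra.
have w2 : H%:R <= w.
  apply: le_trans Hle _; rewrite ler_expR.
  have : (s + e / 4 + (s / 2 + e / 4)) * T <= 5 * T by rewrite ler_wpM2r ?(ltW T0) //; lra.
  by lra.
set W := expR (l - (s / 2 + e / 8) * T) in low.
have w3 : 10 * w <= W.
  have -> : W = w * expR (e / 8 * T) by rewrite -expRD; congr expR; field.
  rewrite mulrC ler_wpM2l ?expR_ge0 //; have := expR_ge1Dx (e / 8 * T); lra.
have G0 : 0 <= G by rewrite ler0n.
have HG : H%:R * G <= h * G by rewrite ler_wpM2r.
have -> : expR (l - (3 * s / 2 + 3 / 8 * e) * T) = W / h.
  by rewrite -expRB; congr expR; field.
rewrite (_ : W / h / 2 = W / 2 / h); last first.
  by field; rewrite gt_eqF //; lra.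
rewrite ler_pdivrMr; last by lra.
by rewrite mulrC; clear -low w1 w2 w3 HG; lra.
Qed.
End Conclusion.

Theorem theorem1p2 (R : realType) :
  exists2 eps0 : R, 0 < eps0 &
  forall eps : R, 0 < eps -> eps < eps0 ->
  exists x0 : R, forall x : R, x0 <= x ->
    x * expR (- ((3 * Num.sqrt 2 / 2 + eps) * Num.sqrt (ln x * ln (ln x))))
    <= (count
          (fun n : nat => ((tn n)%:R : R) <=
             expR (Num.sqrt ((2 + eps) * ln n%:R * ln (ln n%:R))))
          (iota 1 (Num.truncn x)))%:R.
Proof.
exists 2^-1; first by rewrite invr_gt0.
(* The choice makes the loss 16 d of [psi_ge_scales] equal to e / 8. *)
move=> e e0 e1; set d := e / 128.
have d0 : 0 < d by rewrite divr_gt0.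
have d01 : 0 < d <= 2^-1 by rewrite d0 /d /=; clear -e0 e1; lra.
have eB : 1000 <= e * (4 * 2000 / d ^+ 2).
  have : 100 <= 2000 :> R by rewrite ler_nat.
  move: (2000 : R) => K K100.
  have -> : e * (4 * K / d ^+ 2) = 128 * (4 * K) / d.
    by rewrite /d; field; rewrite gt_eqF.
  rewrite (ler_pdivlMr _ _ d0); case/andP: d01 => _ d1; clear -K100 d1; lra.
move: eB; have [B EB] : exists B, B = 4 * 2000 / d ^+ 2 by eexists.
rewrite -EB => BE.
have B1 : 1 <= B by rewrite -(ler_pM2l e0); clear -e0 e1 BE; lra.
have [x0 x0P] := eventually_scales B B1; exists x0 => x /x0P[lx sc].
rewrite -{1 4}lx; move: sc; set l := ln x.
set v := ln l; set T := Num.sqrt (l * v) => sc.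
have low := psi_ge_scales d01; rewrite -EB in low; move/(_ _ _ _ sc): low.
rewrite (_ : 16 * d = e / 8); last by rewrite /d; field.
case: sc => Bv BvT BTl T2 lv low.
have B0 : 0 <= B by apply: le_trans B1.
have v1 : 1 <= v by apply: le_trans Bv.
have BT : B <= T by apply: le_trans BvT; rewrite ler_peMr.
have T0 : 0 <= T by apply: sqrtr_ge0.
have ev : 1000 <= e * v by apply: le_trans BE _; rewrite ler_pM2l.
have eT : 1000 <= e * T by apply: le_trans BE _; rewrite ler_pM2l.
have el : 1000 * T <= e * l.
  by apply: le_trans (ler_wpM2r T0 BE) _; rewrite -mulrA ler_pM2l.
have T5 : 5 * T <= l.
  have l0 : 0 <= l by rewrite -lv expR_ge0.
  have := ler_wpM2r l0 (ltW e1); clear -el T0; lra.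
have e01 : 0 < e <= 1 by rewrite e0; clear -e1; lra.
have eT160 : 160 <= e * T by clear -eT; lra.
have {}low := count_tn_ge e01 eT160 T5 low.
set N := Num.truncn (expR l) in low *.
set H := Num.truncn (expR ((_ + _ / 4) * T)) in low.
(* Integers up to about x ^ (1 - e / 24) are given up; they are negligible because e l >= 1000 T. *)
set n0 := Num.truncn (expR ((1 - e / 24) * l)).
have Hle : H%:R <= expR ((Num.sqrt 2 + e / 4) * T) :> R.
  by have /andP[] := truncn_itv (expR_ge0 ((Num.sqrt 2 + e / 4) * T)).
have /andP[n0le _] := truncn_itv (expR_ge0 ((1 - e / 24) * l)).
have n0lt := truncnS_gt (expR ((1 - e / 24) * l)).
have := @count_le_add (fun n => ((tn n)%:R : R) <=
   expR (Num.sqrt ((2 + e) * ln n%:R * ln (ln n%:R)))) (fun n => tn n <= H)%N n0 N.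
rewrite -(ler_nat R) natrD => /(_ _)/(le_trans low) main.
have {main low}main := main _.
rewrite -(lerD2r n0%:R); apply: le_trans (main _); last first.
  move=> n n0n tH; apply: le_trans (_ : H%:R <= _); first by rewrite ler_nat.
  apply: le_trans Hle _; rewrite ler_expR; apply: (radius_le _ T0 T2 lv).
  - by rewrite e0 ltW.
  - by clear -ev; lra.
  - by apply: le_trans (ltW n0lt) _; rewrite ler_nat.
rewrite -expRD; set W := expR (l + _).
have n0W : n0%:R <= W.
  apply: le_trans n0le _; rewrite ler_expR.
  have /andP[_ s15] := @sqrt2_bounds R.
  have : (3 * Num.sqrt 2 / 2 + e) * T <= 5 * T by rewrite ler_wpM2r //; clear -s15 e1; lra.
  by clear -el T0; lra.
have -> : expR (l - (3 * Num.sqrt 2 / 2 + 3 / 8 * e) * T) = W * expR (5 / 8 * e * T).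
  by rewrite -expRD; congr expR; field.
(* The spare 5 e / 8 in the exponent gains a factor 4, which pays for the halving and for [n0] <=
   [W]. *)
have E4 : 4 <= expR (5 / 8 * e * T).
  by apply: le_trans (expR_ge1Dx _); clear -eT; lra.
have W0 : 0 <= W by apply: expR_ge0.
by have := ler_wpM2l W0 E4; clear -n0W; lra.
Qed.
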